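(* Let $X$ be a real Banach space with dual $X^*$. Then: (a) the norm of $X^*$ is non rough if and only if $X$ has $BDP$; (b) the norm of $X^*$ is weakly average non rough if and only if $X$ has $BHP$; (c) the norm of $X^*$ is average non rough if and only if $X$ has $BSCSP$.
   Context: All Banach spaces are real. $B_{Z}$ denotes the closed unit ball of $Z$. A slice of $B_X$ is a set $S(B_X,x^*,\alpha)=\{x\in B_X: x^*(x)>\sup x^*(B_X)-\alpha\}$ with $x^*\in X^*$, $\alpha>0$. For a Banach space $Z$, a $w^*$-slice of $B_{Z^*}$ is a set $S(B_{Z^*},z,\alpha)=\{z^*\in B_{Z^*}: z^*(z)>\sup_{y^*\in B_{Z^*}}y^*(z)-\alpha\}$ with $z\in Z$, $\alpha>0$. A convex combination of sets $S_1,\dots,S_n$ is $\sum_{i=1}^n\lambda_iS_i$ (Minkowski sum) with $\lambda_i>0$, $\sum_i\lambda_i=1$. For $\varepsilon>0$, the norm of a Banach space $Z$ is: $\varepsilon$-rough if every $w^*$-slice of $B_{Z^*}$ has diameter $\geq\varepsilon$; weakly $\varepsilon$-average rough if every nonempty relatively $w^*$-open subset of $B_{Z^*}$ has diameter $\geq\varepsilon$; $\varepsilon$-average rough if every convex combination of $w^*$-slices of $B_{Z^*}$ has diameter $\geq\varepsilon$. The norm of $Z$ is non rough (resp. weakly average non rough, average non rough) if for no $\varepsilon>0$ is it $\varepsilon$-rough (resp. weakly $\varepsilon$-average rough, $\varepsilon$-average rough). Here these are applied to $Z=X^*$, so $Z^*=X^{**}$ with its $w^*$-topology induced by $X^*$.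 A Banach space $X$ has $BDP$ (Ball Dentable Property) if $B_X$ has slices of arbitrarily small diameter; $BHP$ (Ball Huskable Property) if $B_X$ has nonempty relatively weakly open subsets of arbitrarily small diameter; $BSCSP$ (Ball Small Combination of Slice Property) if $B_X$ has convex combinations of slices of arbitrarily small diameter. *)

(* Defs.v *)
From HB Require Import structures.
From mathcomp Require Import all_boot all_order all_algebra.
From mathcomp Require Import all_classical all_reals.
From mathcomp Require Import ereal topology normedtype.
Set Implicit Arguments.
Unset Strict Implicit.
Unset Printing Implicit Defensive.
Import Order.TTheory GRing.Theory Num.Theory.
Import numFieldNormedType.Exports.
Local Open Scope classical_set_scope.
Local Open Scope ring_scope.

Definition unit_ball (R : realType) (V : normedModType R) : set V :=
  [set x | `|x| <= 1].
Arguments unit_ball {R} V.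

Section dual.
Context (R : realType) (V : normedModType R).

Definition clinear : pred (V -> R^o) :=
  [pred f | `[< linear f >] && `[< continuous f >]].

Structure dual := Dual {
  dual_fun :> V -> R^o ;
  dualP : dual_fun \in clinear }.

HB.instance Definition _ := [isSub for dual_fun].
HB.instance Definition _ := [Choice of dual by <:].

Lemma clinear_submod_closed : submod_closed clinear.
Proof.
split=> [|a f g].
  apply/andP; split; apply/asboolP.
    by move=> a x y; rewrite /= scaler0 addr0.
  exact: cst_continuous.
move=> /andP[/asboolP lf /asboolP cf] /andP[/asboolP lg /asboolP cg].
apply/andP; split; apply/asboolP; first move=> k x y.
  rewrite !fctE lf lg !scalerDr !scalerA mulrC -!addrA; congr (_ + _).
  by rewrite addrCA.
by move=> x; apply: continuousD; [apply: continuousZl_tmp; exact: cf|exact: cg].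
Qed.

HB.instance Definition _ :=
  GRing.isSubmodClosed.Build R (V -> R^o) clinear clinear_submod_closed.
HB.instance Definition _ := [SubChoice_isSubLmodule of dual by <:].

Lemma dual_is_linear (f : dual) : linear f.
Proof. by have /andP[/asboolP] := dualP f. Qed.

HB.instance Definition _ (f : dual) :=
  GRing.isLinear.Build R V R^o *:%R f (@dual_is_linear f).

Lemma dual_continuous (f : dual) : continuous f.
Proof. by have /andP[_ /asboolP] := dualP f. Qed.

Definition dual_norm (f : dual) : R := sup [set `|f x| | x in unit_ball V].

Lemma dual_norm_has_sup (f : dual) :
  has_sup [set `|f x| | x in unit_ball V].
Proof.
split; first by exists `|f 0|, 0 => //; rewrite /unit_ball /= normr0.
have /linear_bounded_continuous/bounded_funP/(_ 1)[M fM] := @dual_continuous f.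
by exists M => _ [x x1 <-]; exact: fM.
Qed.

Lemma dual_norm_ge0 (f : dual) : 0 <= dual_norm f.
Proof.
apply: le_trans (normr_ge0 (f 0)) _.
apply: ub_le_sup; first by case: (dual_norm_has_sup f).
by exists 0 => //; rewrite /unit_ball /= normr0.
Qed.

Lemma ler_dual_norm (f : dual) (x : V) : `|f x| <= dual_norm f * `|x|.
Proof.
have [->|x0] := eqVneq x 0; first by rewrite linear0 !normr0 mulr0.
rewrite -ler_pdivrMr ?normr_gt0//.
apply: ub_le_sup; first by case: (dual_norm_has_sup f).
exists (`|x|^-1 *: x).
  by rewrite /unit_ball /= normrZ normfV normr_id mulVf// normr_eq0.
by rewrite linearZ normrZ normfV normr_id mulrC.
Qed.

Lemma dual_norm_le (f : dual) (M : R) :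
  (forall x, unit_ball V x -> `|f x| <= M) -> dual_norm f <= M.
Proof.
by move=> fM; apply: ge_sup => [|_ [x x1 <-]]; [case: (dual_norm_has_sup f)|exact: fM].
Qed.

Lemma dual_normD (f g : dual) : dual_norm (f + g) <= dual_norm f + dual_norm g.
Proof.
apply: dual_norm_le => x x1; apply: le_trans (ler_normD _ _) _.
by apply: lerD; apply: ub_le_sup; [case: (dual_norm_has_sup f)|exists x
                            |case: (dual_norm_has_sup g)|exists x].
Qed.

Lemma dual_normZ (a : R) (f : dual) : dual_norm (a *: f) = `|a| * dual_norm f.
Proof.
have le (b : R) (g : dual) : dual_norm (b *: g) <= `|b| * dual_norm g.
  apply: dual_norm_le => x x1.
  rewrite [_ x](_ : _ = b *: g x)// normrZ ler_wpM2l//.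
  by apply: ub_le_sup; [case: (dual_norm_has_sup g)|exists x].
apply/eqP; rewrite eq_le le/=.
have [->|a0] := eqVneq a 0; first by rewrite normr0 mul0r dual_norm_ge0.
rewrite -ler_pdivlMl ?normr_gt0// -normfV -{1}[f]scale1r -(mulVf a0) -scalerA.
exact: le.
Qed.

Lemma dual_norm_eq0 (f : dual) : dual_norm f = 0 -> f = 0.
Proof.
move=> f0; apply: val_inj; apply/funext => x.
by apply/eqP; rewrite -normr_le0 (le_trans (ler_dual_norm f x))// f0 mul0r.
Qed.

HB.instance Definition _ := Lmodule_isNormed.Build R dual
  dual_normD dual_normZ dual_norm_eq0.

End dual.
Arguments dual {R} V.

(* The weak topology on V is the coarsest one for which all f : dual V are
   continuous; the weak* topology on dual V, the coarsest one for which all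
   evaluations at points of V are. Both are initial for a map into a product of
   lines. *)
Definition weak_topology (R : realType) (V : normedModType R) :=
  initial_topology (fun x : V => (fun f => f x) : {ptws dual V -> R^o}).
Arguments weak_topology {R} V.

Definition weak_star_topology (R : realType) (V : normedModType R) :=
  initial_topology (fun f : dual V => (fun x => f x) : {ptws V -> R^o}).
Arguments weak_star_topology {R} V.

Section geometry.
Context (R : realType) (V : normedModType R).

(* The value -oo at the empty set is never used: slices, and convex combinations
   of slices, are nonempty. *)
Definition diameter (A : set V) : \bar R :=
  ereal_sup [set `|p.1 - p.2|%:E | p in A `*` A].

Definition slice (f : dual V) (alpha : R) : set V :=
  [set x | unit_ball V x /\ sup [set f y | y in unit_ball V] - alpha < f x].

Definition weak_star_slice (x : V) (alpha : R) : set (dual V) :=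
  [set f | unit_ball (dual V) f /\
    sup [set (g : dual V) x | g in unit_ball (dual V)] - alpha < f x].

Definition is_slice (A : set V) :=
  exists f alpha, 0 < alpha /\ A = slice f alpha.

Definition is_weak_star_slice (A : set (dual V)) :=
  exists x alpha, 0 < alpha /\ A = weak_star_slice x alpha.

Definition is_rel_weak_open (A : set V) :=
  exists2 U : set (weak_topology V), open U & A = U `&` unit_ball V.

Definition is_rel_weak_star_open (A : set (dual V)) :=
  exists2 U : set (weak_star_topology V), open U & A = U `&` unit_ball (dual V).

(* C is a Minkowski sum of lam i *: S i, the S i being members of F; n = 0 is
   excluded by the weights summing to 1. *)
Definition is_convex_combination (F : set (set V)) (C : set V) :=
  exists (n : nat) (lam : 'I_n -> R) (S : 'I_n -> set V),
    [/\ forall i, 0 < lam i, \sum_(i < n) lam i = 1, forall i, F (S i) &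
        C = [set \sum_(i < n) lam i *: s i | s in [set s | forall i, S i (s i)]]].

End geometry.

Section properties.
Context (R : realType) (V : normedModType R).
Local Open Scope ereal_scope.

Definition rough (eps : R) :=
  forall A, is_weak_star_slice (V := V) A -> eps%:E <= diameter A.

Definition weakly_average_rough (eps : R) :=
  forall A, is_rel_weak_star_open (V := V) A -> A !=set0 ->
    eps%:E <= diameter A.

Definition average_rough (eps : R) :=
  forall A, is_convex_combination (is_weak_star_slice (V := V)) A ->
    eps%:E <= diameter A.

Definition non_rough := ~ exists2 eps, (0 < eps)%R & rough eps.

Definition weakly_average_non_rough :=
  ~ exists2 eps, (0 < eps)%R & weakly_average_rough eps.

Definition average_non_rough :=
  ~ exists2 eps, (0 < eps)%R & average_rough eps.

Definition BDP := forall eps : R, (0 < eps)%R ->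
  exists2 A, is_slice (V := V) A & diameter A < eps%:E.

Definition BHP := forall eps : R, (0 < eps)%R ->
  exists A, [/\ is_rel_weak_open (V := V) A, A !=set0 & diameter A < eps%:E].

Definition BSCSP := forall eps : R, (0 < eps)%R ->
  exists2 A, is_convex_combination (is_slice (V := V)) A &
    diameter A < eps%:E.

End properties.
Arguments rough {R} V eps.
Arguments weakly_average_rough {R} V eps.
Arguments average_rough {R} V eps.
Arguments non_rough {R} V.
Arguments weakly_average_non_rough {R} V.
Arguments average_non_rough {R} V.
Arguments BDP {R} V.
Arguments BHP {R} V.
Arguments BSCSP {R} V.

(* Main.v *)
(* Let J be the canonical embedding of X into its bidual. A slice of the ball of
   X, a relatively weakly open subset of it, or a convex combination of slices
   is mapped by J into the set of the corresponding weak* kind in the ball of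
   the bidual that is defined by the same data. By Goldstine's theorem each
   point of the larger set is approximated, against any given functional, by
   points of the smaller one; as norms in the bidual are suprema over
   functionals and J is isometric, both sets have the same diameter.

   J is isometric because a minimal sublinear functional below the norm is
   linear; Goldstine's theorem only involves finitely many functionals, and
   follows from minimising a squared distance in a finite-dimensional space. *)

From HB Require Import structures.
Require Import Defs.
From mathcomp Require Import all_boot all_order all_algebra.
From mathcomp Require Import all_classical all_reals.
From mathcomp Require Import ereal topology normedtype.
From mathcomp Require Import ring lra.
Set Implicit Arguments.
Unset Strict Implicit.
Unset Printing Implicit Defensive.
Import Order.TTheory GRing.Theory Num.Theory.
Import numFieldNormedType.Exports.
Local Open Scope classical_set_scope.
Local Open Scope ring_scope.

(** * Bounded linear functionals *)

Section bounded_functionals.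
Context (R : realType) (V : normedModType R).

Lemma bounded_clinear (f : V -> R^o) (M : R) :
  linear f -> (forall x, `|f x| <= M * `|x|) -> f \in @clinear R V.
Proof.
move=> lf fM; apply/andP; split; apply/asboolP => //.
pose F : {linear V -> R^o} := HB.pack f (GRing.isLinear.Build _ _ _ _ f lf).
apply: (@linear_bounded_continuous _ _ _ F).1.
apply/bounded_funP => r; exists (`|M| * `|r|) => x xr.
rewrite (le_trans (fM x))// (le_trans (ler_norm _))// normrM normr_id.
by rewrite ler_wpM2l// (le_trans xr)// ler_norm.
Qed.

Lemma dual_le_norm (f : dual V) (x : V) : `|f x| <= `|f| * `|x|.
Proof. exact: ler_dual_norm. Qed.

End bounded_functionals.

(** * The canonical embedding into the bidual *)

Section bidual.
Context (R : realType) (V : normedModType R).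

Lemma to_bidual_clinear (x : V) :
  (fun f : dual V => f x : R^o) \in @clinear R (dual V).
Proof.
apply: (@bounded_clinear _ _ _ `|x|) => // f.
by rewrite mulrC dual_le_norm.
Qed.

Definition to_bidual (x : V) : dual (dual V) := Dual (to_bidual_clinear x).

Lemma to_bidual_linear : linear to_bidual.
Proof. by move=> a x y; apply/val_inj/funext => f; exact: linearP. Qed.

HB.instance Definition _ :=
  GRing.isLinear.Build R V (dual (dual V)) *:%R to_bidual to_bidual_linear.

End bidual.

(** * Norming functionals from minimal sublinear functionals *)

Section norming_functional.
Context (R : realType) (V : normedModType R).
Implicit Types (p q : V -> R) (x y z : V).

(** The upper bound by the norm, with subadditivity, also bounds [p x] from below by minus the norm
    of [x], so the pointwise infima formed from such functionals are finite. *)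
Definition sublinear p :=
  [/\ forall x y, p (x + y) <= p x + p y,
      forall a x, 0 < a -> p (a *: x) <= a * p x &
      forall x, p x <= `|x| ].

Lemma sublinear_norm : sublinear (fun x => `|x|).
Proof.
by split=> // [x y|a x a0]; [exact: ler_normD|rewrite normrZ gtr0_norm].
Qed.

Lemma sublinear0 p : sublinear p -> p 0 = 0.
Proof.
move=> [pD _ pN]; apply/eqP; rewrite eq_le.
have := pN 0; have := pD 0 0; rewrite addr0 normr0; lra.
Qed.

Lemma sublinearZ p a x : sublinear p -> 0 <= a -> p (a *: x) = a * p x.
Proof.
move=> sp; rewrite le_eqVlt => /predU1P[<-|a0].
  by rewrite scale0r mul0r sublinear0.
have [_ pZ _] := sp; apply/eqP; rewrite eq_le pZ//=.
have := pZ a^-1 (a *: x); rewrite invr_gt0 scalerA mulVf ?gt_eqF// scale1r.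
by rewrite ler_pdivlMl//; exact.
Qed.

Lemma sublinear_ge p x y : sublinear p -> - `|y| <= p (x + y) - p x.
Proof.
move=> [pD _ pN]; have := pD (x + y) (- y); have := pN (- y).
rewrite addrK normrN; lra.
Qed.

Lemma sublinear_geN p x : sublinear p -> - `|x| <= p x.
Proof.
by move=> sp; have := sublinear_ge 0 x sp; rewrite add0r sublinear0// subr0.
Qed.

(* The term t = 1 gives steer p y x <= p (x + y) - p y, so a minimal p, being
   equal to steer p y for all y, is superadditive as well. *)
Definition steer p y x :=
  inf [set p (x + t *: y) - t * p y | t in [set t | 0 <= t]].

Lemma steer_has_inf p y x : sublinear p ->
  has_inf [set p (x + t *: y) - t * p y | t in [set t | 0 <= t]].
Proof.
move=> sp; split; first by exists (p (x + 0 *: y) - 0 * p y), 0 => /=.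
exists (- `|x|) => _ [t /= t0 <-].
have := sublinear_ge (t *: y) x sp; rewrite [t *: y + x]addrC => H.
by rewrite -sublinearZ.
Qed.

Lemma steer_le p y x t : sublinear p -> 0 <= t ->
  steer p y x <= p (x + t *: y) - t * p y.
Proof.
move=> sp t0; apply: ge_inf; last by exists t.
by case: (steer_has_inf y x sp).
Qed.

Lemma steer_le_self p y x : sublinear p -> steer p y x <= p x.
Proof.
move=> sp; have := steer_le y x sp (lexx 0).
by rewrite scale0r addr0 mul0r subr0.
Qed.

(** Near-optimal parameters [s] for [x] and [t] for [z] yield the parameter [s + t] for [x + z]; a
    parameter [t] for [x] yields [a * t] for [a *: x]. *)
Lemma sublinear_steer p y : sublinear p -> sublinear (steer p y).
Proof.
move=> sp; have [pD pZ pN] := sp; split=> [x z|a x a0|x].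
- apply/ler_addgt0Pr => e e0; have e20 : 0 < e / 2 by rewrite divr_gt0.
  have [_ [s /= s0 <-] hs] := inf_adherent e20 (steer_has_inf y x sp).
  have [_ [t /= t0 <-] ht] := inf_adherent e20 (steer_has_inf y z sp).
  apply: le_trans (steer_le y (x + z) sp (addr_ge0 s0 t0)) _.
  have := pD (x + s *: y) (z + t *: y).
  rewrite addrACA -scalerDl; rewrite -/(steer p y x) in hs.
  rewrite -/(steer p y z) in ht; lra.
- rewrite -ler_pdivrMl//; apply: lb_le_inf.
    by case: (steer_has_inf y x sp).
  move=> _ [t /= t0 <-]; rewrite ler_pdivrMl//.
  apply: le_trans (steer_le y (a *: x) sp (mulr_ge0 (ltW a0) t0)) _.
  by rewrite -scalerA -scalerDr mulrBr mulrA lerD2r pZ.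
- exact: le_trans (steer_le_self _ _ sp) _.
Qed.

(** Zorn's lemma applies because the pointwise infimum of a nonempty chain of sublinear functionals
    is again sublinear. *)
Lemma minimal_sublinear p0 : sublinear p0 -> exists p,
  [/\ sublinear p, forall x, p x <= p0 x &
      forall q, sublinear q -> (forall x, q x <= p x) -> q = p].
Proof.
move=> sp0.
pose T := {p : V -> R | sublinear p /\ forall x, p x <= p0 x}.
(* The order is reversed, so that a maximal element is a minimal functional. *)
pose below (p q : T) := `[< forall x, sval q x <= sval p x >].
pose t0 : T := exist _ p0 (conj sp0 (fun=> lexx _)).
have [|r s t /asboolP rs /asboolP st|A Atot|[p [sp pp0]] pmin] :=
    @ZL_preorder T t0 below.
- by move=> t; exact/asboolP.
- by apply/asboolP => x; exact: le_trans (st x) (rs x).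
- have [[a0 Aa0]|A0] := pselect (A !=set0); last first.
    by exists t0 => s As; exfalso; apply: A0; exists s.
  pose val_at x := [set sval a x | a in A].
  have hi x : has_inf (val_at x).
    split; first by exists (sval a0 x), a0.
    exists (- `|x|) => _ [a Aa <-].
    by case: (svalP a) => sa _; exact: sublinear_geN.
  pose m x := inf (val_at x).
  have mle a x : A a -> m x <= sval a x.
    by move=> Aa; apply: ge_inf; [case: (hi x)|exists a].
  have sm : sublinear m.
    split=> [x y|c x c0|x].
    + apply/ler_addgt0Pr => e e0; have e20 : 0 < e / 2 by rewrite divr_gt0.
      have [_ [a Aa <-]] := inf_adherent e20 (hi x).
      have [_ [b Ab <-]] := inf_adherent e20 (hi y).
      rewrite -/(m x) -/(m y) => hb ha.
      (* The smaller of the two chain members is near-optimal at both [x] and [y]. *)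
      have [/asboolP/(_ x) ba|/asboolP/(_ y) ab] := Atot _ _ Aa Ab.
      * have [[bD _ _] _] := svalP b.
        have := bD x y; have := mle b (x + y) Ab; lra.
      * have [[aD _ _] _] := svalP a.
        have := aD x y; have := mle a (x + y) Aa; lra.
    + rewrite -ler_pdivrMl//; apply: lb_le_inf; first by case: (hi x).
      move=> _ [a Aa <-]; rewrite ler_pdivrMl//.
      apply: le_trans (mle a _ Aa) _.
      by have [[_ + _] _] := svalP a; apply.
    + apply: le_trans (mle a0 x Aa0) _.
      by have [[_ _ +] _] := svalP a0; apply.
  have mp0 x : m x <= p0 x.
    by apply: le_trans (mle a0 x Aa0) _; have [_ +] := svalP a0; apply.
  exists (exist _ m (conj sm mp0)) => s As; apply/asboolP => x /=.
  exact: mle.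
- exists p; split => // q sq qp; apply/funext => x.
  apply/eqP; rewrite eq_le qp/=.
  have qp0 z : q z <= p0 z by exact: le_trans (qp z) (pp0 z).
  have /pmin/asboolP : below (exist _ p (conj sp pp0))
      (exist _ q (conj sq qp0)).
    exact/asboolP.
  exact.
Qed.

Lemma minimal_sublinear_linear p : sublinear p ->
  (forall q, sublinear q -> (forall x, q x <= p x) -> q = p) ->
  linear (p : V -> R^o).
Proof.
move=> sp pmin; have [pD pZ pN] := sp.
have padd x y : p (x + y) = p x + p y.
  apply/eqP; rewrite eq_le pD/=.
  have := steer_le y x sp ler01.
  rewrite (pmin _ (sublinear_steer y sp)) ?scale1r ?mul1r; first lra.
  by move=> z; exact: steer_le_self.
have popp x : p (- x) = - p x.
  by have := padd x (- x); rewrite subrr sublinear0//; lra.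
move=> a x y; rewrite padd; congr (_ + _).
have [a0|a0] := leP 0 a; first exact: sublinearZ.
have b0 : 0 <= - a by lra.
rewrite -[a]opprK; move: (- a) b0 => b b0.
by rewrite !scaleNr popp sublinearZ.
Qed.

Lemma norming_functional x : exists2 f : dual V, `|f| <= 1 & f x = `|x|.
Proof.
(* Starting from the steered norm forces [p (- x)] to be at most minus the norm of [x] (parameter
   1), hence [p x] to be at least the norm. *)
have [p [sp px pmin]] := minimal_sublinear (sublinear_steer x sublinear_norm).
have lp := minimal_sublinear_linear sp pmin.
have pN y : `|p y| <= 1 * `|y|.
  rewrite mul1r ler_norml; case: (sp) => _ _ ->; rewrite andbT.
  exact: sublinear_geN.
exists (Dual (bounded_clinear lp pN)).
  by apply: dual_norm_le => y /= y1; rewrite (le_trans (pN y))// mul1r.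
apply/eqP; rewrite eq_le/=; case: (sp) => _ _ ->/=.
have := steer_le x (- x) sublinear_norm ler01.
rewrite scale1r addNr normr0 mul1r sub0r => /(le_trans (px _)).
have [pD _ _] := sp; have := pD x (- x); rewrite subrr sublinear0//; lra.
Qed.
End norming_functional.

(** * Goldstine's theorem *)

Section goldstine.
Context (R : realType) (V : normedModType R).
Implicit Types (x y : V) (f : dual V) (g : dual (dual V)) (s : seq (dual V)).

Lemma dual_sumE (I : Type) (r : seq I) (P : pred I) (F : I -> dual V) x :
  (\sum_(i <- r | P i) F i) x = \sum_(i <- r | P i) F i x.
Proof. exact: (linear_sum (to_bidual x)). Qed.

Lemma unit_ball_segment x y (t : R) : 0 <= t <= 1 ->
  unit_ball V x -> unit_ball V y -> unit_ball V (x + t *: (y - x)).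
Proof.
rewrite /unit_ball /= => /andP[t0 t1] x1 y1.
have -> : x + t *: (y - x) = (1 - t) *: x + t *: y.
  by rewrite scalerBr scalerBl scale1r addrA addrAC.
apply: le_trans (ler_normD _ _) _; rewrite !normrZ !ger0_norm ?subr_ge0//.
have := ler_wpM2l t0 y1.
have t10 : 0 <= 1 - t by rewrite subr_ge0.
have := ler_wpM2l t10 x1; lra.
Qed.

(** The ball is symmetric, so a one-sided bound controls the absolute value. *)
Lemma dual_norm_leN f (M : R) :
  (forall x, unit_ball V x -> f x <= M) -> `|f| <= M.
Proof.
move=> fM; apply: dual_norm_le => x x1; rewrite ler_norml fM// andbT.
have := fM (- x); rewrite /unit_ball/= normrN => /(_ x1).
by rewrite linearN lerNl.
Qed.

Lemma goldstine_finite g s (e : R) : unit_ball (dual (dual V)) g -> 0 < e ->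
  exists2 x, unit_ball V x & {in s, forall f, `|f x - g f| < e}.
Proof.
rewrite /unit_ball /= => g1 e0.
(* A near-minimiser x of the squared distance D between (f x) and (g f), f in s,
   makes the gradient functional F almost norming at x, so that D x, which is
   g F - F x, is at most `|F| - F x, hence small. *)
pose D x := \sum_(f <- s) (f x - g f) ^+ 2.
pose E := [set D x | x in unit_ball V].
have ball0 : unit_ball V 0 by rewrite /unit_ball /= normr0.
have D0 x : 0 <= D x by apply: sumr_ge0 => f _; exact: sqr_ge0.
have hE : has_inf E.
  by split; [exists (D 0), 0|exists 0 => _ [x _ <-]].
pose d := inf E.
have dle x : unit_ball V x -> d <= D x.
  by move=> x1; apply: ge_inf; [case: hE|exists x].
(* If [d <= 0], some [x] in the ball has [D x < e ^+ 2], which bounds each single square. *)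
suff d0 : d <= 0.
  have e20 : 0 < e ^+ 2 by rewrite exprn_gt0.
  have [_ [x x1 <-] Dx] := inf_adherent e20 hE.
  exists x => // f fs; rewrite -(ltr_pXn2r (n := 2)) ?nnegrE ?(ltW e0)//.
  rewrite real_normK ?num_real//; apply: le_lt_trans (_ : D x < _); last first.
    by rewrite -/d in Dx; lra.
  rewrite /D (big_rem f fs) /= lerDl; apply: sumr_ge0 => h _; exact: sqr_ge0.
rewrite leNgt; apply/negP => d0.
pose M := \sum_(f <- s) (2 * `|f|) ^+ 2.
have M0 : 0 <= M by apply: sumr_ge0 => f _; exact: sqr_ge0.
(* [M] bounds the quadratic term of [D] along segments in the ball. The step length [t] is at most
   1, to stay in the ball, and makes the final error [t * (1 + M)] smaller than [d]. *)
pose t := d / (d + (1 + M)).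
have t0 : 0 < t by rewrite divr_gt0//; lra.
have t1 : t <= 1 by rewrite ler_pdivrMr; lra.
have tM : t * (1 + M) < d.
  by rewrite mulrAC ltr_pdivrMr ?ltr_pM2l; lra.
(* The tolerance [t ^+ 2] matches the quadratic term, so that dividing by [t] leaves an error of
   order [t]. *)
have [_ [x x1 <-] Dx] := inf_adherent (exprn_gt0 2 t0) hE.
rewrite -/d in Dx.
pose F : dual V := \sum_(f <- s) (g f - f x) *: f.
have FE y : F y = \sum_(f <- s) (g f - f x) * f y by exact: dual_sumE.
have gF : g F = \sum_(f <- s) (g f - f x) * g f.
  by rewrite linear_sum; apply: eq_bigr => f _; rewrite linearZ.
have DF : D x = g F - F x.
  rewrite FE gF -sumrB; apply: eq_bigr => f _.
  have sqrE (a b : R) : (a - b) ^+ 2 = (b - a) * b - (b - a) * a by ring.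
  exact: sqrE.
have Fn : `|F| <= F x + t * (1 + M).
  apply: dual_norm_leN => y y1.
  have t01 : 0 <= t <= 1 by rewrite ltW.
  have := dle _ (unit_ball_segment t01 x1 y1).
  have -> : D (x + t *: (y - x)) =
      D x - t * 2 * (F y - F x) + t ^+ 2 * \sum_(f <- s) (f y - f x) ^+ 2.
    rewrite !FE -sumrB !mulr_sumr -sumrB -big_split; apply: eq_bigr => f _ /=.
    rewrite linearD linearZ linearB/=.
    have sqrE (a b c u : R) : (a + u * (b - a) - c) ^+ 2 =
        (a - c) ^+ 2 - u * 2 * ((c - a) * b - (c - a) * a) +
        u ^+ 2 * (b - a) ^+ 2 by ring.
    exact: sqrE.
  have : \sum_(f <- s) (f y - f x) ^+ 2 <= M.
    apply: ler_sum => f _; rewrite -[leLHS]real_normK ?num_real//.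
    rewrite ler_pXn2r ?nnegrE ?mulr_ge0//.
    apply: le_trans (ler_normB _ _) _.
    have := dual_le_norm f y; have := dual_le_norm f x.
    have := ler_wpM2l (normr_ge0 f) x1; have := ler_wpM2l (normr_ge0 f) y1.
    lra.
  move: (\sum_(f <- s) _) => Q QM h.
  have {}h : t * (2 * (F y - F x)) <= t * (t * (1 + M)).
    have := ler_wpM2l (sqr_ge0 t) QM; lra.
  move: h; rewrite ler_pM2l// => h.
  have : 0 <= t * (1 + M) by rewrite mulr_ge0 ?ltW//; lra.
  lra.
have gFn : g F <= `|F|.
  apply: le_trans (ler_norm _) _; apply: le_trans (dual_le_norm g F) _.
  exact: ler_piMl.
have := dle x x1; lra.
Qed.

Lemma to_bidual_weak_star_dense (U : set (weak_star_topology (dual V))) g :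
  open U -> U g -> unit_ball (dual (dual V)) g ->
  exists2 x, unit_ball V x & U (to_bidual x).
Proof.
move=> [O Oo <-] Og g1.
(* The sets [N p] generate a filter converging pointwise to [g]. Hence [O] contains one of them, and
   the finite form of Goldstine's theorem supplies a point in it. *)
pose N (p : seq (dual V) * R) : set (dual V -> R^o) :=
  [set h | exists x, [/\ unit_ball V x, h = to_bidual x :> (_ -> _) &
                         {in p.1, forall f, `|f x - g f| < p.2}]].
pose F := filter_from [set p : seq (dual V) * R | 0 < p.2] N.
have FF : Filter F.
  apply: filter_from_filter; first by exists ([::], 1) => /=.
  move=> [s a] [r b] /= a0 b0; exists (s ++ r, Num.min a b) => /=.
    by rewrite lt_min a0.
  move=> h [x [x1 hx xg]]; split; exists x; split=> //= f fs.
    by have := xg f; rewrite /= mem_cat fs lt_min => /(_ isT)/andP[].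
  by have := xg f; rewrite /= mem_cat fs orbT lt_min => /(_ isT)/andP[].
have Fg : {ptws, F --> (g : dual V -> R^o)}.
  apply/pointwise_cvgP => f; apply/cvgrPdist_lt => e e0.
  exists ([:: f], e) => //= h [x [x1 -> /(_ f)]] /=.
  by rewrite inE eqxx distrC; exact.
have : nbhs (g : {ptws dual V -> R^o}) O by exact: open_nbhs_nbhs.
move=> /Fg [[s e] /= e0 NO].
have [x x1 xg] := goldstine_finite s g1 e0.
by exists x => //; apply: NO; exists x.
Qed.

End goldstine.

(** * Diameters of slices and of their convex combinations *)

Section diameters.
Context (R : realType) (V : normedModType R).
Implicit Types (x y : V) (f : dual V) (g h : dual (dual V)).

Lemma to_bidual_norm x : `|to_bidual x| = `|x|.
Proof.
apply/eqP; rewrite eq_le; apply/andP; split.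
  apply: dual_norm_le => f f1; apply: le_trans (dual_le_norm f x) _.
  exact: ler_piMl.
have [f f1 fx] := norming_functional x.
rewrite -fx; apply: le_trans (ler_norm _) _.
apply: le_trans (dual_le_norm (to_bidual x) f) _.
exact: ler_piMr.
Qed.

(** One functional is tested at a time, and [x] may depend on it. This suffices for diameters, and
    it passes to convex combinations. *)
Definition weak_star_approx (A : set V) (B : set (dual (dual V))) :=
  forall g f (e : R), B g -> 0 < e -> exists2 x, A x & `|f x - g f| < e.

Lemma diameter_to_bidual (A : set V) (B : set (dual (dual V))) :
  (forall x, A x -> B (to_bidual x)) -> weak_star_approx A B ->
  diameter A = diameter B.
Proof.
move=> AB BA; apply/eqP; rewrite eq_le; apply/andP; split.
  apply: ge_ereal_sup => _ [[x y] [/= Ax Ay] <-].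
  apply: ereal_sup_ubound; exists (to_bidual x, to_bidual y) => /=.
    by split; exact: AB.
  by rewrite -linearB to_bidual_norm.
apply: ge_ereal_sup => _ [[g h] [/= Bg Bh] <-].
have Adiam x y : A x -> A y -> (`|x - y|%:E <= diameter A)%E.
  by move=> Ax Ay; apply: ereal_sup_ubound; exists (x, y).
case: (diameter A) Adiam => [d| |] Adiam; first last.
- have [x Ax _] := BA g 0 1 Bg ltr01.
  by have := Adiam x x Ax Ax; rewrite leeNy_eq.
- exact: leey.
rewrite lee_fin /=; apply: dual_norm_leN => f f1.
rewrite [X in X <= _](_ : _ = g f - h f)//.
apply/ler_addgt0Pr => e e0; have e20 : 0 < e / 2 by rewrite divr_gt0.
have [x Ax xg] := BA g f _ Bg e20; have [y Ay yh] := BA h f _ Bh e20.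
have := Adiam x y Ax Ay; rewrite lee_fin => xyd.
have := dual_le_norm f (x - y).
have := ler_piMl (normr_ge0 (x - y)) f1.
have := ler_norm (f (x - y)); rewrite linearB/=.
move: xg yh; rewrite !ltr_norml => /andP[? ?] /andP[? ?]; lra.
Qed.

(** Both suprema equal the norm of [f], so a slice and the weak* slice with the same data have the
    same threshold. *)
Lemma sup_bidual_ball f :
  sup [set (g : dual (dual V)) f | g in unit_ball (dual (dual V))] =
  sup [set f x | x in unit_ball V].
Proof.
have ball0 (W : normedModType R) : unit_ball W 0.
  by rewrite /unit_ball /= normr0.
have ub (W : normedModType R) (k : dual W) :
    ubound [set k x | x in unit_ball W] `|k|.
  move=> _ [x x1 <-]; apply: le_trans (ler_norm _) _.
  apply: le_trans (dual_le_norm k x) _; exact: ler_piMr.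
apply/eqP; rewrite eq_le; apply/andP; split; apply: ge_sup.
- by exists ((0 : dual (dual V)) f), 0.
- move=> _ [g g1 <-].
  apply: (@le_trans _ _ `|f|).
    apply: le_trans (ler_norm _) _; apply: le_trans (dual_le_norm g f) _.
    exact: ler_piMl.
  apply: dual_norm_leN => x x1; apply: ub_le_sup; last by exists x.
  by exists `|f|; exact: ub.
- by exists (f 0), 0.
- move=> _ [x x1 <-]; apply: ub_le_sup.
    exists `|to_bidual f|; move=> _ [g g1 <-]; apply: (ub _ (to_bidual f)).
    by exists g.
  by exists (to_bidual x) => //; rewrite /unit_ball/= to_bidual_norm.
Qed.

Lemma slice_to_bidual f (a : R) x :
  slice f a x -> weak_star_slice f a (to_bidual x).
Proof.
by move=> [x1 fx]; split; rewrite /unit_ball/= ?to_bidual_norm ?sup_bidual_ball.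
Qed.

Lemma weak_star_slice_approx f (a : R) :
  weak_star_approx (slice f a) (weak_star_slice f a).
Proof.
move=> g k e [g1 fg] e0; rewrite sup_bidual_ball in fg.
(* Approximating [g] at [f] to within its margin over the threshold puts [x] in the slice; [k] is
   the functional tested. *)
have [|x x1 xg] := @goldstine_finite _ _ g [:: f; k]
    (Num.min e (g f - (sup [set f x | x in unit_ball V] - a))) g1.
  by rewrite lt_min e0/= subr_gt0.
exists x.
  split=> //; have := xg f; rewrite !inE eqxx lt_min => /(_ isT)/andP[_].
  rewrite ltr_norml => /andP[+ _]; lra.
by have := xg k; rewrite !inE eqxx orbT lt_min => /(_ isT)/andP[].
Qed.

Lemma diameter_slice f (a : R) :
  diameter (slice f a) = diameter (weak_star_slice f a).
Proof.
apply: diameter_to_bidual; last exact: weak_star_slice_approx.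
exact: slice_to_bidual.
Qed.

(** Each summand is approximated to within the same [e]; the total error is at most a convex average
    of errors below [e]. *)
Lemma weak_star_approx_sum n (lam : 'I_n -> R) (S : 'I_n -> set V)
    (T : 'I_n -> set (dual (dual V))) :
  (forall i, 0 < lam i) -> \sum_(i < n) lam i = 1 ->
  (forall i, weak_star_approx (S i) (T i)) ->
  weak_star_approx
    [set \sum_(i < n) lam i *: s i | s in [set s | forall i, S i (s i)]]
    [set \sum_(i < n) lam i *: s i | s in [set s | forall i, T i (s i)]].
Proof.
move=> lam0 lam1 ST _ f e [t Tt <-] e0.
have /choice[s sP] i : exists x, S i x /\ `|f x - t i f| < e.
  by have [x] := ST i (t i) f e (Tt i) e0; exists x.
exists (\sum_(i < n) lam i *: s i); first by exists s => // i; have [] := sP i.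
have -> : (\sum_(i < n) lam i *: t i) f = \sum_(i < n) lam i * t i f.
  exact: dual_sumE.
rewrite linear_sum -sumrB /=.
(* Strict inequalities survive summation only over a nonempty range; [n = 0] contradicts the weights
   summing to 1. *)
have [n0|n0] := posnP n.
  move: lam1; rewrite big1 => [/esym/eqP|i _]; first by rewrite oner_eq0.
  by have := ltn_ord i; rewrite [X in (_ < X)%N]n0.
rewrite -[ltRHS]mul1r -lam1 mulr_suml.
apply: le_lt_trans (ler_norm_sum _ _ _) _.
apply: ltr_sum => [|i _].
  by apply/hasP; exists (Ordinal n0); rewrite ?mem_index_enum.
rewrite linearZ/= -[_ *: _]/(_ * _) -mulrBr normrM gtr0_norm// ltr_pM2l//.
by have [] := sP i.
Qed.

Lemma diameter_slice_sum n (lam : 'I_n -> R) (f : 'I_n -> dual V)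
    (a : 'I_n -> R) :
  (forall i, 0 < lam i) -> \sum_(i < n) lam i = 1 ->
  diameter [set \sum_(i < n) lam i *: s i |
             s in [set s | forall i, slice (f i) (a i) (s i)]] =
  diameter [set \sum_(i < n) lam i *: s i |
             s in [set s | forall i, weak_star_slice (f i) (a i) (s i)]].
Proof.
move=> lam0 lam1; apply: diameter_to_bidual.
  move=> _ [s Ss <-]; exists (fun i => to_bidual (s i)) => [i|].
    exact: slice_to_bidual.
  by rewrite linear_sum; apply: eq_bigr => i _; rewrite linearZ.
by apply: (@weak_star_approx_sum _ _ (fun i => slice (f i) (a i))
  (fun i => weak_star_slice (f i) (a i))) => // i;
  exact: weak_star_slice_approx.
Qed.

End diameters.

(** The abstract family [S] covers both slices and weak* slices; choice turns the existence of data
    for each summand into functions of the index. *)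
Lemma convex_combination_parametricP (R : realType) (V : normedModType R)
    (T : Type) (S : T -> R -> set V) (A : set V) :
  is_convex_combination [set B | exists f a, 0 < a /\ B = S f a] A <->
  exists n (lam : 'I_n -> R) (f : 'I_n -> T) (a : 'I_n -> R),
    [/\ forall i, 0 < lam i, \sum_(i < n) lam i = 1, forall i, 0 < a i &
     A = [set \sum_(i < n) lam i *: s i |
           s in [set s | forall i, S (f i) (a i) (s i)]]].
Proof.
split=> [[n [lam [B [lam0 lam1 BS ->]]]]|[n [lam [f [a [lam0 lam1 a0 ->]]]]]].
  have /choice[f /choice[a fa]] := BS.
  exists n, lam, f, a; split=> // [i|]; first by case: (fa i).
  have -> // : B = fun i => S (f i) (a i).
  by apply/funext => i; case: (fa i).
by exists n, lam, (fun i => S (f i) (a i)); split=> // i; exists (f i), (a i).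
Qed.

(** * Relatively weakly open sets *)

Section weakly_open.
Context (R : realType) (V : normedModType R).

(** The weak topology of [V] and the weak* topology of its bidual are pulled back from the same
    product of lines, so one open [O] defines both sets. *)
Lemma diameter_weak_star_open (O : set {ptws dual V -> R^o}) : open O ->
  let A := [set x : V | O (to_bidual x : _ -> _)] `&` unit_ball V in
  let B := [set g : dual (dual V) | O (g : _ -> _)] `&`
    unit_ball (dual (dual V)) in
  (A !=set0 <-> B !=set0) /\ diameter A = diameter B.
Proof.
move=> Oo A B.
have AB x : A x -> B (to_bidual x).
  by move=> [Ox x1]; split=> //; rewrite /unit_ball/= to_bidual_norm.
have BA : weak_star_approx A B.
  move=> g f e [Og g1] e0.
  (* Closeness to [g] at [f] is itself an open condition, so density in [O'] gives membership and
     approximation together. *)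
  pose O' := O `&` (fun h : {ptws dual V -> R^o} => h f) @^-1` ball (g f) e.
  have O'o : open O'.
    apply: openI => //.
    have /continuousP projf : continuous (@proj (dual V) (fun=> R^o) f :
        {ptws dual V -> R^o} -> R^o).
      exact: proj_continuous.
    exact/projf/ball_open.
  have [||x x1 [Ox xg]] := @to_bidual_weak_star_dense _ _
      ((fun h : dual (dual V) => (h : _ -> _)) @^-1` O') g _ _ g1.
  - by exists O'.
  - by split=> //; exact: ballxx.
  by exists x => //; rewrite distrC.
split; last exact: diameter_to_bidual.
split=> [[x /AB Bx]|[g Bg]]; first by exists (to_bidual x).
by have [x Ax _] := BA g 0 1 Bg ltr01; exists x.
Qed.

End weakly_open.

(** * The three equivalences *)

(** Common form of the three equivalences: the absence of a uniform lower bound on diameters means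
    arbitrarily small members, and these transfer between families with the same diameters. *)
Lemma not_uniformly_large (R : realType) (V W : normedModType R)
    (F : set (set V)) (G : set (set W)) :
  (forall A, F A -> exists2 B, G B & diameter A = diameter B) ->
  (forall B, G B -> exists2 A, F A & diameter B = diameter A) ->
  ~ (exists2 e : R, 0 < e & forall A, F A -> (e%:E <= diameter A)%E) <->
  forall e : R, 0 < e -> exists2 B, G B & (diameter B < e%:E)%E.
Proof.
move=> FG GF; split=> [small e e0|small [e e0 large]].
  apply: contrapT => none; apply: small; exists e => // A /FG[B GB ->].
  by rewrite leNgt; apply/negP => Be; apply: none; exists B.
have [B /GF[A FA ->]] := small e e0.
by rewrite ltNge large.
Qed.

Theorem proposition2p4 (R : realType) (X : completeNormedModType R) :
  [/\ non_rough (dual X) <-> BDP X,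
      weakly_average_non_rough (dual X) <-> BHP X &
      average_non_rough (dual X) <-> BSCSP X].
Proof.
split.
- apply: not_uniformly_large => [_ [f [a [a0 ->]]]|_ [f [a [a0 ->]]]].
    by exists (slice f a); [exists f, a|rewrite diameter_slice].
  by exists (weak_star_slice f a); [exists f, a|exact: diameter_slice].
(* Nonemptiness is made part of the family, to fit the common form. *)
- have BHPE : BHP X <-> forall e : R, 0 < e -> exists2 A,
      is_rel_weak_open (V := X) A /\ A !=set0 & (diameter A < e%:E)%E.
    split=> small e e0; first by have [A [? ? ?]] := small e e0; exists A.
    by have [A [? ?] ?] := small e e0; exists A.
  rewrite BHPE.
  rewrite -(@not_uniformly_large _ _ _
    [set A | is_rel_weak_star_open (V := dual X) A /\ A !=set0]).
  + rewrite /weakly_average_non_rough /weakly_average_rough.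
    split=> rgh [e e0 h]; apply: rgh; exists e => // A.
      by move=> ? ?; exact: h.
    by case; exact: h.
  + move=> _ [[U [O Oo <-] ->] B0].
    have [[_ AB] dAB] := diameter_weak_star_open Oo.
    by eexists; [split; [eexists; [exists O|reflexivity]|exact: AB]|].
  + move=> _ [[U [O Oo <-] ->] B0].
    have [[AB _] dAB] := diameter_weak_star_open Oo.
    by eexists; [split; [eexists; [exists O|reflexivity]|exact: AB]|].
- apply: not_uniformly_large => A.
    move=> /convex_combination_parametricP[n [lam [f [a [lam0 lam1 a0 ->]]]]].
    eexists; last by rewrite -diameter_slice_sum.
    by apply/convex_combination_parametricP; exists n, lam, f, a.
  move=> /convex_combination_parametricP[n [lam [f [a [lam0 lam1 a0 ->]]]]].
  eexists; last by rewrite diameter_slice_sum.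
  by apply/convex_combination_parametricP; exists n, lam, f, a.
Qed.
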